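(* Let $d=(d_1,\dots,d_n)$ be a graphic list (the degree sequence of some simple graph on vertex set $[n]=\{1,\dots,n\}$). Let $P(d)\subseteq\mathbb{R}^{\binom{n}{2}}$ be the set of all points $x=(x_{ij})$, with coordinates indexed by unordered pairs $\{i,j\}$ of distinct elements of $[n]$, satisfying $$\sum_{i\in[n],\, i\neq j} x_{ij}=d_j\quad (1\le j\le n),\qquad 0\le x_{ij}\le 1\quad(1\le i<j\le n).$$ Let $h\in P(d)$, and let $R_h$ be the graph on $[n]$ whose edges are the pairs $ij$ for which $h_{ij}$ is not an integer. Then $h$ is a vertex (extreme point) of $P(d)$ if and only if the edges of $R_h$ form vertex-disjoint odd cycles (i.e., every vertex of $R_h$ has degree $0$ or $2$ and every cycle of $R_h$ has odd length). Furthermore, if $h$ is a vertex of $P(d)$, then the number of these cycles is even and every nonintegral coordinate of $h$ equals $1/2$.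
   Context: Here $x_{ij}$ and $x_{ji}$ denote the same coordinate. The point $h$ may be viewed as a labeling of the edges of the complete graph on $[n]$ (a ''fractional realization'' of $d$), where edge $ij$ receives label $h_{ij}$. *)

(* Defs.v *)
From mathcomp Require Import all_boot all_order all_algebra.
From mathcomp Require Import all_classical all_reals.

Set Implicit Arguments.
Unset Strict Implicit.
Unset Printing Implicit Defensive.

Import Order.TTheory GRing.Theory Num.Theory.

Local Open Scope classical_set_scope.
Local Open Scope ring_scope.

Section Graphs.
Variable T : finType.
Implicit Types (e : rel T) (c : seq T).

Definition simple_graph e : Prop := symmetric e /\ irreflexive e.

Definition degree e (v : T) : nat := #|[set w | e v w]%SET|.

(* The lower bound on the size excludes the closed walk [:: v; w] that runs
   back and forth along one edge. *)
Definition is_cycle e c : bool := (2 < size c)%N && ucycleb e c.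

Definition cycle_edges c : {set {set T}} :=
  [set [set v; next c v]%SET | v in c]%SET.

(* A cycle, as a subgraph, is identified with its edge set, so that the
   choice of a starting vertex and of a direction is forgotten. *)
Definition cycles e : {set {set {set T}}} :=
  [set F | `[< exists2 c, is_cycle e c & F = cycle_edges c >]]%SET.

Definition disjoint_odd_cycles e : Prop :=
  (forall v, degree e v = 0%N \/ degree e v = 2%N) /\
  (forall c, is_cycle e c -> odd (size c)).

End Graphs.

Definition graphic (n : nat) (d : 'I_n -> nat) : Prop :=
  exists2 e : rel 'I_n, simple_graph e & forall i, degree e i = d i.

Definition extreme_point (R : realType) (V : lmodType R) (A : set V) (x : V)
  : Prop :=
  A x /\ forall (y z : V) (t : R), A y -> A z -> 0 < t < 1 ->
    x = t *: y + (1 - t) *: z -> y = x /\ z = x.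

Definition upair (n : nat) := {e : {set 'I_n} | #|e| == 2%N}.

(* R^o is R as a module over itself, which makes {ffun upair n -> R^o} an
   lmodType R.  The value is x_{ij} when i != j; on the diagonal it takes the junk value 0. *)
Definition edge_label (R : realType) (n : nat) (x : {ffun upair n -> R^o})
    (i j : 'I_n) : R :=
  if insub [set i; j]%SET is Some e then x e else 0.

Definition realization_polytope (R : realType) (n : nat) (d : 'I_n -> nat)
  : set {ffun upair n -> R^o} :=
  [set x | (forall j, \sum_(i < n | i != j) edge_label x i j = (d j)%:R) /\
           (forall i j : 'I_n, (i < j)%N -> 0 <= edge_label x i j <= 1)].

Definition nonintegral_graph (R : realType) (n : nat)
    (h : {ffun upair n -> R^o}) : rel 'I_n :=
  fun i j => (i != j) && (edge_label h i j \isn't a Num.int).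

(* Main.v *)
Require Import Defs.
From mathcomp Require Import all_boot all_order all_algebra.
From mathcomp Require Import all_classical all_reals.
From mathcomp Require Import lra zify.

Set Implicit Arguments.
Unset Strict Implicit.
Unset Printing Implicit Defensive.

Import Order.TTheory GRing.Theory Num.Theory.

Local Open Scope ring_scope.

(** The point h is extreme iff no nonzero labeling of the edges of R_h has all
    vertex sums equal to 0, i.e. iff the rows of the edge-vertex incidence
    matrix of R_h are linearly independent.

    Since the d_j are integers, no vertex of R_h has degree 1.  Independence
    gives |E(R_h)| <= |V'|, where V' is the set of non-isolated vertices;
    together with the degree sum this forces all degrees on V' to be 2.  The
    incidence matrix is then square, so its columns are independent too, which
    excludes even cycles.  Conversely a labeling with zero vertex sums
    alternates in sign along each cycle, so it vanishes on odd cycles.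

    The labeling h - 1/2 on R_h has zero vertex sums, hence vanishes.  Summing
    h over all edges gives half of the even number \sum_j d_j, so |E(R_h)| is
    even; as the odd cycles partition E(R_h), there is an even number of
    them. *)

(** * Successors in duplicate-free cyclic sequences *)

Lemma next_next_neq (T : eqType) (c : seq T) (x : T) :
  uniq c -> (2 < size c)%N -> x \in c -> next c (next c x) != x.
Proof.
move=> Uc sz_c xc; case: (rot_to xc) => i s Es.
rewrite -!(next_rot i Uc); move: Uc sz_c.
rewrite -(rot_uniq i) -(size_rot i) Es.
case: s {Es} => [|y [|z s]] //= /and3P[].
rewrite !inE !negb_or => /and3P[nxy nxz _] _ _ _.
by rewrite !eqxx [y == x]eq_sym (negPf nxy) eq_sym.
Qed.

(** The index grows by 1 except at the wrap-around from the last position to 0, where the parity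
    still flips because the length is even. *)
Lemma odd_index_next (T : eqType) (c : seq T) (x : T) :
  uniq c -> ~~ odd (size c) -> x \in c ->
  odd (index (next c x) c) = ~~ odd (index x c).
Proof.
case: c => // y c' Uc even_c xc; rewrite next_nth xc.
set c := y :: c' in Uc even_c xc *; set k := index x c.
have ltk : (k < size c)%N by rewrite index_mem.
rewrite /= in ltk; move: ltk; rewrite ltnS leq_eqVlt => /predU1P[Ek|ltk].
  rewrite nth_default ?Ek // /c /= eqxx.
  by move: even_c; rewrite /= negbK => ->.
have -> : nth y c' k = nth y c k.+1 by [].
by rewrite index_uniq.
Qed.

(** * Handshake lemma *)

Section SimpleGraph.
Variables (T : finType) (e : rel T).
Hypotheses (sym_e : symmetric e) (irr_e : irreflexive e).

Lemma degreeE (v : T) : degree e v = (\sum_w e v w)%N.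
Proof.
rewrite /degree -sum1_card big_mkcond; apply: eq_bigr => w _.
by rewrite inE; case: (e v w).
Qed.

Lemma odd_sum_degree : ~~ odd (\sum_v degree e v)%N.
Proof.
(* Ranking the vertices splits the ordered adjacent pairs into ascending and descending ones;
   symmetry makes the two counts equal, so the total is a double. *)
pose r (x : T) : nat := enum_rank x.
have split_e v w :
    (e v w = (e v w && (r v < r w)) + (e v w && (r w < r v)) :> nat)%N.
  case: (ltngtP (r v) (r w)) => [||/ord_inj/enum_rank_inj->];
    by rewrite ?irr_e ?andbT ?andbF ?addn0.
have -> : (\sum_v degree e v =
    \sum_v \sum_w (e v w && (r v < r w)) +
    \sum_v \sum_w (e v w && (r w < r v)))%N.
  rewrite -big_split; apply: eq_bigr => v _.
  by rewrite degreeE -big_split; apply: eq_bigr => w _; exact: split_e.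
rewrite [X in (_ + X)%N]exchange_big /=.
under [X in (_ + X)%N]eq_bigr do under eq_bigr do rewrite sym_e.
by rewrite addnn odd_double.
Qed.

End SimpleGraph.

(** * Graphs with all degrees 0 or 2, and their partition into cycles *)

Section TwoRegular.
Variables (T : finType) (e : rel T).
Hypotheses (sym_e : symmetric e) (irr_e : irreflexive e).
Hypothesis deg_e : forall v, degree e v = 0%N \/ degree e v = 2%N.
Implicit Types (c : seq T) (u v w x y : T).

Lemma degree2 v w : e v w -> degree e v = 2%N.
Proof.
move=> evw; case: (deg_e v) => // /eqP; rewrite cards_eq0 => /eqP/setP/(_ w).
by rewrite !inE evw.
Qed.

Lemma next_neq_prev c x : is_cycle e c -> x \in c -> next c x != prev c x.
Proof.
case/andP=> sz_c /andP[cyc_c Uc] xc; apply: contra (next_next_neq Uc sz_c xc).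
by move/eqP->; rewrite next_prev.
Qed.

(** Predecessor and successor are two distinct neighbours, and degree 2 leaves room for no other. *)
Lemma cycle_neighbours c x : is_cycle e c -> x \in c ->
  [set y | e x y]%SET = [set prev c x; next c x]%SET.
Proof.
move=> cc xc; have npn := next_neq_prev cc xc.
case/andP: cc => sz_c /andP[cyc_c Uc]; apply/esym/eqP.
have exn := next_cycle cyc_c xc; have epx := prev_cycle cyc_c xc.
rewrite eqEcard; apply/andP; split.
  apply/fintype.subsetP => y; rewrite !inE => /orP[]/eqP-> //.
  by rewrite sym_e.
by rewrite -/(degree e x) (degree2 exn) cards2 eq_sym npn.
Qed.

Lemma cycle_neighbour c x y : is_cycle e c -> x \in c -> e x y ->
  y = prev c x \/ y = next c x.
Proof.
move=> cc xc exy; have := cycle_neighbours cc xc.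
by move/setP/(_ y); rewrite !inE exy => /esym/orP[]/eqP; [left|right].
Qed.

Lemma cycle_closed c : is_cycle e c -> closed e (mem c).
Proof.
move=> cc; have cl x y : e x y -> x \in c -> y \in c.
  move=> exy xc; case: (cycle_neighbour cc xc exy) => ->.
    by rewrite mem_prev.
  by rewrite mem_next.
move=> x y exy; apply/idP/idP; first exact: cl.
by apply: cl; rewrite sym_e.
Qed.

(** This description depends only on the vertex set of [c], not on the order in which it is
    traversed. *)
Lemma cycle_edgesE c : is_cycle e c ->
  cycle_edges c = [set [set p.1; p.2]%SET |
    p in [set p : T * T | (p.1 \in c) && e p.1 p.2]]%SET.
Proof.
move=> cc; have /andP[sz_c /andP[cyc_c Uc]] := cc.
apply/setP => F; apply/imsetP/imsetP => [[v vc ->]|[[v w]]].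
  exists (v, next c v) => //; rewrite inE /=.
  have -> : v \in c by [].
  exact: next_cycle.
rewrite inE /= => /andP[vc evw] ->.
case: (cycle_neighbour cc vc evw) => ->; last by exists v.
exists (prev c v); first by rewrite mem_prev.
by rewrite next_prev // finset.setUC.
Qed.

Lemma card_cycle_edges c : is_cycle e c -> #|cycle_edges c| = size c.
Proof.
move=> cc; have /andP[sz_c /andP[cyc_c Uc]] := cc.
rewrite card_in_imset; first by rewrite (card_uniqP Uc).
move=> v w vc wc /setP Evw; apply: contraNeq (next_next_neq Uc sz_c vc) => nvw.
have := Evw v; rewrite !inE eqxx (negPf nvw) /= => /esym/eqP Ev.
have := Evw w; rewrite !inE eqxx eq_sym (negPf nvw) /= => /eqP <-.
by rewrite -Ev.
Qed.

(** The vertex set of a cycle is connected and closed under adjacency, so both cycles have the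
    component of [x] as vertex set. *)
Lemma cycle_edges_eq c1 c2 x : is_cycle e c1 -> is_cycle e c2 ->
  x \in c1 -> x \in c2 -> cycle_edges c1 = cycle_edges c2.
Proof.
move=> cc1 cc2 xc1 xc2; rewrite !cycle_edgesE //.
suff Ec : c1 =i c2.
  by congr [set _ | _ in pred_of_set _]%SET; apply/setP => p; rewrite !inE Ec.
have sub c c' : is_cycle e c -> is_cycle e c' -> x \in c -> x \in c' ->
    {subset c <= c'}.
  move=> cc cc' xc xc' y yc; have /andP[_ /andP[cyc_c _]] := cc.
  have cxy : connect e x y by exact: connect_cycle yc.
  have -> // : (y \in c') = (x \in c').
  by apply/esym; exact: (closed_connect (cycle_closed cc') cxy).
by move=> y; apply/idP/idP; apply: sub.
Qed.

(* Deleting v leaves its two neighbours with degree 1, and no other vertex of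
   odd degree, so by the handshake lemma they lie in the same component. *)
Lemma cycle_through v w : e v w -> exists2 c, is_cycle e c & v \in c.
Proof.
move=> evw; have /cards2P[a [b [nab Nv]]] := introT eqP (degree2 evw).
have Nve x : e v x = (x == a) || (x == b).
  by move/setP/(_ x): Nv; rewrite !inE.
pose e' x y := [&& e x y, x != v & y != v].
have sym_e' : symmetric e' by move=> x y; rewrite /e' sym_e [(_ != v) && _]andbC.
have avoid_v x p : path e' x p -> all (predC1 v) p.
  by elim: p x => //= y p IH x /andP[/and3P[_ _ ->] /IH].
(* Restricting [e'] to the component of [a] gives a graph to which the handshake lemma applies. *)
pose f x y := e' x y && connect e' a x.
have sym_f : symmetric f.
  move=> x y; rewrite /f sym_e'; case e'xy: (e' y x) => //=.
  have cxy : connect e' x y by apply: connect1; rewrite sym_e'.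
  have cs := sym_connect_sym sym_e'.
  by rewrite ![connect e' a _]cs (same_connect cs cxy).
have irr_f : irreflexive f by move=> x; rewrite /f /e' irr_e.
have deg_e' x : x != v -> (degree e' x + e x v = degree e x)%N.
  move=> nxv; rewrite !degreeE (bigD1 v) //= [RHS](bigD1 v) //=.
  rewrite {1}/e' eqxx !andbF add0n addnC; congr (_ + _)%N.
  by apply: eq_bigr => y nyv; rewrite /e' nxv nyv !andbT.
have deg_f x : degree f x = (if connect e' a x then degree e' x else 0)%N.
  rewrite !degreeE /f; case: ifP => _; first by under eq_bigr do rewrite andbT.
  by rewrite big1 // => y _; rewrite andbF.
have eav : e a v by rewrite sym_e Nve eqxx.
have nav : a != v by apply: contraTneq eav => ->; rewrite irr_e.
have cab : connect e' a b.
  apply: contraTT (odd_sum_degree sym_f irr_f) => ncab; rewrite negbK.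
  rewrite (bigD1 a) //= oddD deg_f connect0.
  have -> : degree e' a = 1%N.
    have := deg_e' a nav; rewrite eav (degree2 eav) => /eqP.
    by rewrite addn1 eqSS => /eqP.
  rewrite addTb; elim/big_ind: _ => // [m n|x nxa].
    by rewrite oddD => /negPf-> /negPf->.
  rewrite deg_f; case: ifP => // cax.
  have nxv : x != v.
    apply: contraTneq cax => ->; apply/negP => /connectP[p].
    case: p => [_ /= Eva|
      y p /avoid_v/allP/(_ (last y p) (mem_last y p)) /= nv Ev].
      by rewrite Eva eqxx in nav.
    by rewrite -Ev eqxx in nv.
  have nxb : x != b by apply: contraTneq cax => ->.
  have := deg_e' x nxv; rewrite sym_e Nve (negPf nxa) (negPf nxb) addn0 => ->.
  by case: (deg_e x) => ->.
have /connectP[p0 e'p0 Eb] := cab; have := Eb; case/shortenP: e'p0 => p e'p Up _ {}Eb.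
(* A simple path from [a] to [b] avoiding [v] is closed up through [v]; since [a != b], [p] is
   nonempty and the cycle has at least 3 vertices. *)
exists (v :: a :: p); last exact: mem_head.
have pe' : path e a p by apply: sub_path e'p => x y /and3P[].
have vp : v \notin a :: p.
  rewrite inE negb_or eq_sym nav /=.
  by apply/negP => /(allP (avoid_v a p e'p)) /=; rewrite eqxx.
apply/andP; split.
  by case: p Eb {e'p Up pe' vp} => //= Eab; rewrite Eab eqxx in nab.
rewrite /ucycleb cons_uniq vp Up /= rcons_path pe' -Eb Nve eqxx /=.
by rewrite sym_e Nve eqxx orbT.
Qed.

Definition graph_edges : {set {set T}} :=
  [set [set p.1; p.2]%SET | p in [set p : T * T | e p.1 p.2]]%SET.

Lemma mem_cycles F :
  reflect (exists2 c, is_cycle e c & F = cycle_edges c) (F \in cycles e).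
Proof. by rewrite inE; exact: asboolP. Qed.

Lemma cover_cycles : finset.cover (cycles e) = graph_edges.
Proof.
apply/setP => A; apply/bigcupP/imsetP => [[F /mem_cycles[c cc ->]]|[[v w]]].
  rewrite cycle_edgesE // => /imsetP[p]; rewrite inE => /andP[_ ep] ->.
  by exists p; rewrite ?inE.
rewrite inE /= => evw ->; have [c cc vc] := cycle_through evw.
exists (cycle_edges c); first by apply/mem_cycles; exists c.
by rewrite cycle_edgesE //; apply/imsetP; exists (v, w); rewrite // inE /= vc.
Qed.

Lemma trivIset_cycles : finset.trivIset (cycles e).
Proof.
apply/finset.trivIsetP => _ _ /mem_cycles[c cc ->] /mem_cycles[c' cc' ->].
apply: contraNT => /pred0Pn[F /andP[]] /= /imsetP[v vc ->].
move=> /imsetP[x xc' /setP/(_ v)]; rewrite !inE eqxx /= => /esym/orP[]/eqP Ev.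
  by rewrite (cycle_edges_eq cc cc' vc) // Ev.
by rewrite (cycle_edges_eq cc cc' vc) // Ev mem_next.
Qed.

(** The cycles partition the edges into blocks of odd size, so modulo 2 each block counts as 1. *)
Lemma odd_card_cycles : (forall c, is_cycle e c -> odd (size c)) ->
  odd #|cycles e| = odd #|graph_edges|.
Proof.
move=> odd_e; rewrite -cover_cycles; have /eqP <- := trivIset_cycles.
rewrite -sum1_card; apply: (big_ind2 (fun m n => odd m = odd n)) => //.
  by move=> ? ? ? ?; rewrite !oddD => -> ->.
by move=> _ /mem_cycles[c cc ->]; rewrite card_cycle_edges // odd_e.
Qed.

End TwoRegular.

(** * Labelings of unordered pairs and vertex sums *)

Section PairSets.
Variables (R : realType) (n : nat).
Implicit Types (x z h : {ffun upair n -> R^o}) (p : upair n) (A : {set upair n}).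

Lemma upairP p : exists i j : 'I_n, (i < j)%N /\ val p = [set i; j]%SET.
Proof.
have /cards2P[i [j [nij Ep]]] := valP p.
case: (ltngtP i j) => [ltij|ltji|/ord_inj Eij]; last by rewrite Eij eqxx in nij.
  by exists i, j.
by exists j, i; rewrite Ep finset.setUC.
Qed.

Lemma sum_upair (V : nmodType) (g : 'I_n -> V) p i j :
  val p = [set i; j]%SET -> \sum_(k in val p) g k = g i + g j.
Proof.
move=> Ep; have := valP p; rewrite Ep cards2; case: (eqVneq i j) => // nij _.
by rewrite finset.big_setU1 ?finset.big_set1 // inE.
Qed.

(** The sum has at most one term, and it is empty on the diagonal, in agreement with the default 0.
    This form allows exchange of summations. *)
Lemma edge_labelE x i j :
  edge_label x i j = \sum_(p : upair n | val p == [set i; j]%SET) x p.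
Proof.
rewrite /edge_label; case: insubP => [p _ Ep|nij].
  by rewrite (big_pred1 p) // => q; rewrite -Ep val_eqE.
by rewrite big1 // => p /eqP Ep; case/negP: nij; rewrite -Ep (valP p).
Qed.

Lemma edge_label_val x p i j : val p = [set i; j]%SET -> edge_label x i j = x p.
Proof.
by move=> Ep; rewrite edge_labelE (big_pred1 p) // => q; rewrite -Ep val_eqE.
Qed.

Lemma edge_labelC x i j : edge_label x i j = edge_label x j i.
Proof. by rewrite /edge_label finset.setUC. Qed.

Lemma sum_edge_label x j :
  \sum_(i < n | i != j) edge_label x i j = \sum_(p : upair n | j \in val p) x p.
Proof.
under eq_bigr do rewrite edge_labelE.
rewrite (exchange_big_dep predT) //= [RHS]big_mkcond; apply: eq_bigr => p _.
have [a [b [ltab Ep]]] := upairP p.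
have nab : a != b by apply: contraTneq ltab => ->; rewrite ltnn.
rewrite (eq_bigl (fun i => (i != j) && ([set a; b] == [set i; j])%SET));
  last by move=> i; rewrite Ep.
have eq_set2 i : i != j -> ([set a; b] == [set i; j])%SET =
    ((a == i) && (b == j)) || ((a == j) && (b == i)).
  move=> nij; apply/eqP/orP => [/setP Es|[]/andP[/eqP-> /eqP->] //]; last first.
    by rewrite finset.setUC.
  have := Es a; have := Es b; rewrite !inE !eqxx orbT /=.
  move=> /esym/orP[/eqP Eb|/eqP Eb] /esym/orP[/eqP Ea|/eqP Ea];
    subst; rewrite ?eqxx ?orbT //.
  - by rewrite eqxx in nab.
  - by right.
  - by left.
  - by rewrite eqxx in nab.
rewrite Ep !inE; case: ifP => [/orP[]/eqP Ej|].
- rewrite (big_pred1 b) // => i /=; have [->|nij] := eqVneq i j.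
    by rewrite Ej (negPf nab).
  by rewrite eq_set2 // Ej eqxx [b == a]eq_sym (negPf nab) andbF /= eq_sym.
- rewrite (big_pred1 a) // => i /=; have [->|nij] := eqVneq i j.
    by rewrite Ej [b == a]eq_sym (negPf nab).
  by rewrite eq_set2 // Ej eqxx (negPf nab) andbT orbF eq_sym.
move=> /negbT; rewrite negb_or => /andP[nja njb]; rewrite big_pred0 // => i.
have [//|nij] := eqVneq i j; rewrite eq_set2 //.
by rewrite ![_ == j]eq_sym (negPf nja) (negPf njb) !andbF.
Qed.

Lemma realization_polytopeP (d : 'I_n -> nat) x : realization_polytope d x <->
  (forall j, \sum_(p : upair n | j \in val p) x p = (d j)%:R) /\
  (forall p, 0 <= (x p : R) <= 1).
Proof.
split=> -[x_d x01]; split.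
- by move=> j; rewrite -sum_edge_label.
- move=> p; have [i [j [ltij Ep]]] := upairP p.
  by rewrite -(edge_label_val x Ep) x01.
- by move=> j; rewrite sum_edge_label.
move=> i j _; rewrite /edge_label; case: insub => [p|]; first exact: x01.
by rewrite lexx ler01.
Qed.

(** * Graph of a set of pairs, and independence of its incidence rows *)

Definition pair_graph A : rel 'I_n :=
  fun i j => [exists p in A, val p == [set i; j]%SET].

Lemma pair_graphP A i j :
  reflect (exists2 p, p \in A & val p = [set i; j]%SET) (pair_graph A i j).
Proof.
by apply: (iffP exists_inP) => -[p pA /eqP]; exists p => //; apply/eqP.
Qed.

Lemma pair_graph_sym A : symmetric (pair_graph A).
Proof. by move=> i j; rewrite /pair_graph finset.setUC. Qed.

Lemma pair_graph_irr A : irreflexive (pair_graph A).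
Proof.
move=> i; apply/pair_graphP => -[p _ Ep].
by have := valP p; rewrite Ep finset.setUid cards1.
Qed.

Lemma degree_pair_graph A j :
  degree (pair_graph A) j = #|[set p in A | j \in val p]%SET|.
Proof.
(* Neighbours [w] of [j] and pairs through [j] are both mapped injectively to the two-element sets
   [[set j; w]]. *)
rewrite -(card_imset _ val_inj) /degree.
rewrite -(@card_in_imset _ _ (fun w => [set j; w]%SET)); last first.
  move=> v w; rewrite !inE => jv _ /setP/(_ v).
  rewrite !inE eqxx orbT => /esym/orP[]/eqP // Ev.
  by move: jv; rewrite Ev pair_graph_irr.
congr #|pred_of_set _|; apply/setP => F; apply/imsetP/imsetP => -[].
  move=> w; rewrite inE => /pair_graphP[p pA Ep] ->.
  by exists p; rewrite // inE pA Ep !inE eqxx.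
move=> p; rewrite inE => /andP[pA]; have [a [b [_ Ep]]] := upairP p.
rewrite Ep !inE => /orP[]/eqP-> ->; [exists b | exists a] => //;
  rewrite ?inE; try (apply/pair_graphP; exists p => //); by rewrite finset.setUC.
Qed.

Lemma sum_degree_pair_graph A :
  (\sum_j degree (pair_graph A) j = 2 * #|A|)%N.
Proof.
under eq_bigr do rewrite degree_pair_graph -sum1dep_card.
rewrite (exchange_big_dep [in A]) /=; last by move=> j p _ /andP[].
rewrite mulnC -sum_nat_const; apply: eq_bigr => p pA.
by rewrite sum1_card pA; exact/eqP/(valP p).
Qed.

Lemma graph_edges_pair_graph A : graph_edges (pair_graph A) = (val @: A)%SET.
Proof.
apply/setP => F; apply/imsetP/imsetP => -[].
  by move=> [i j]; rewrite inE => /pair_graphP[p pA Ep] ->; exists p.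
move=> p pA ->; have [i [j [_ Ep]]] := upairP p.
by exists (i, j) => //; rewrite inE; apply/pair_graphP; exists p.
Qed.

(** Linear independence of the rows indexed by [A] in the pair-vertex incidence matrix; [z] is a row
    relation extended by 0 outside [A]. *)
Definition incidence_free A := forall z,
  (forall p, p \notin A -> z p = 0) ->
  (forall j, \sum_(p : upair n | j \in val p) z p = 0) -> z = 0.

Lemma incidence_free_odd A :
  (forall j, degree (pair_graph A) j = 0%N \/ degree (pair_graph A) j = 2%N) ->
  (forall c, is_cycle (pair_graph A) c -> odd (size c)) -> incidence_free A.
Proof.
set e := pair_graph A => deg_e odd_e z zA z0.
have sym_e : symmetric e by exact: pair_graph_sym.
have irr_e : irreflexive e by exact: pair_graph_irr.
have label0 i j : ~~ e i j -> edge_label z i j = 0.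
  move=> neij; rewrite edge_labelE big1 // => p /eqP Ep; apply: zA.
  by apply: contra neij => pA; apply/pair_graphP; exists p.
have label_cycle c v : is_cycle e c -> v \in c -> edge_label z v (next c v) = 0.
  move=> cc; have /andP[_ /andP[cyc_c Uc]] := cc.
  pose g v := edge_label z v (next c v).
  (* Only the two cycle edges at [next c x] can carry nonzero labels, and their labels sum to 0. *)
  have g_next (x : 'I_n) : x \in c -> g (next c x) = - g x.
    move=> xc; set y := next c x; have yc : y \in c by rewrite mem_next.
    apply/eqP; rewrite -addr_eq0; apply/eqP.
    have := z0 y; rewrite -sum_edge_label.
    have npn := next_neq_prev cc yc.
    have Ex : prev c y = x by rewrite prev_next.
    have exy : e x y by exact: next_cycle.
    have eyn : e y (next c y) by exact: next_cycle.
    rewrite (bigD1 x) /=; last first.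
      by apply: contraTneq exy => ->; rewrite irr_e.
    rewrite (bigD1 (next c y)) /=; last first.
      rewrite -{1}Ex npn andbT.
      by apply: contraTneq eyn => ->; rewrite irr_e.
    rewrite big1 ?addr0.
      by rewrite addrC [edge_label z (next c y) y]edge_labelC.
    move=> i /andP[/andP[_ nix] nin]; apply: label0; rewrite sym_e.
    apply/negP => /(cycle_neighbour sym_e deg_e cc yc); rewrite Ex => -[] Ei.
      by rewrite Ei eqxx in nix.
    by rewrite Ei eqxx in nin.
  move=> vc; have g_iter k : (iter k (next c) v \in c) &&
      (g (iter k (next c) v) == (-1) ^+ k * g v).
    elim: k => [|k /andP[kc /eqP IH]] /=; first by rewrite vc mul1r eqxx.
    by rewrite mem_next kc g_next // IH exprS mulN1r mulNr eqxx.
  (* One full turn returns to [v] after an odd number of sign changes, so [g v = - g v]. *)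
  have /andP[_] := g_iter (size c).
  rewrite -{1}(order_cycle (cycle_next Uc) Uc vc) (iter_order_cycle (cycle_next Uc)) //.
  rewrite -signr_odd odd_e // expr1 mulN1r -addr_eq0 -mulr2n mulrn_eq0 /=.
  by move/eqP.
apply/ffunP => p; rewrite ffunE; have [pA|/zA //] := boolP (p \in A).
have [v [w [_ Ep]]] := upairP p.
have evw : e v w by apply/pair_graphP; exists p.
rewrite -(edge_label_val z Ep).
have [c cc vc] := cycle_through sym_e irr_e deg_e evw.
have /andP[_ /andP[_ Uc]] := cc.
case: (cycle_neighbour sym_e deg_e cc vc evw) => ->; last exact: label_cycle.
by rewrite edge_labelC -{2}(next_prev Uc v) label_cycle // mem_prev.
Qed.

(** * From independence to disjoint odd cycles *)

Section Forward.
Variable A : {set upair n}.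
Hypothesis free_A : incidence_free A.
Let e := pair_graph A.
Hypothesis deg1 : forall j, degree e j != 1%N.
Let V := [set j | degree e j != 0%N]%SET.
Let B : 'M[R]_(#|A|, #|V|) :=
  \matrix_(i < #|A|, j < #|V|) (enum_val j \in val (enum_val i))%:R.

Let sub_V p : p \in A -> val p \subset V.
Proof.
move=> pA; apply/fintype.subsetP => j jp; rewrite inE degree_pair_graph.
by rewrite cards_eq0; apply/set0Pn; exists p; rewrite inE pA.
Qed.

Let row_free_B : row_free B.
Proof.
apply: inj_row_free => v vB.
(* The row vector [v] is turned into a labeling vanishing off [A]; its vertex sums on [V] are the
   entries of [v *m B]. *)
pose z : {ffun upair n -> R^o} := [ffun p => \sum_(i | enum_val i == p) v 0 i].
have zE i : z (enum_val i) = v 0 i.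
  by rewrite ffunE (big_pred1 i) // => k; rewrite (inj_eq enum_val_inj).
suff z0 : z = 0 by apply/rowP => i; rewrite -zE z0 !ffunE mxE.
apply: free_A => [p npA|j].
  by rewrite ffunE big1 // => i /eqP Ei; rewrite -Ei enum_valP in npA.
have [jV|jV] := boolP (j \in V); last first.
  rewrite big1 // => p jp; rewrite ffunE big1 // => i /eqP Ei.
  case/negP: jV; apply: (fintype.subsetP (sub_V (enum_valP i))).
  by rewrite Ei.
have /rowP/(_ (enum_rank_in jV j)) := vB; rewrite !mxE => E.
rewrite -[RHS]E; under eq_bigr do rewrite ffunE.
rewrite (exchange_big_dep predT) //=; apply: eq_bigr => i _.
rewrite mxE enum_rankK_in //; case: (boolP (j \in val (enum_val i))) => jp.
  rewrite mulr1 (big_pred1 (enum_val i)) // => p.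
  by rewrite andbC [RHS]eq_sym; case: eqP => // <-.
by rewrite mulr0 big1 // => p /andP[jp' /eqP Ep]; rewrite Ep jp' in jp.
Qed.

Let deg_V j : j \in V -> (2 <= degree e j)%N.
Proof. by rewrite inE; have := deg1 j; case: (degree e j) => [|[]]. Qed.

Let sum_V : (\sum_(j in V) degree e j = 2 * #|A|)%N.
Proof.
rewrite -sum_degree_pair_graph [RHS](bigID [in V]) /=.
rewrite [X in (_ + X)%N]big1 ?addn0 // => j.
by rewrite inE negbK => /eqP.
Qed.

(** The rank of [B] bounds the number of rows by the number of columns; the degree sum with all
    degrees on [V] at least 2 gives the converse. *)
Let card_A : #|A| = #|V|.
Proof.
apply/eqP; rewrite eqn_leq; apply/andP; split.
  by rewrite -(eqP row_free_B) rank_leq_col.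
rewrite -(leq_pmul2l (isT : 0 < 2)%N) -sum_V mulnC -sum_nat_const.
exact: leq_sum.
Qed.

(* Linear independence of the |A| rows of the incidence matrix and the lower
   bound 2 on the degrees force |A| = |V|, hence equality in every degree. *)
Lemma incidence_free_degree j : degree e j = 0%N \/ degree e j = 2%N.
Proof.
have [jV|] := boolP (j \in V); last by rewrite inE negbK => /eqP; left.
right; have /leqif_sum[_] :
    forall i, i \in V -> (2 <= degree e i ?= iff (degree e i == 2))%N.
  by move=> i iV; split; [exact: deg_V | rewrite eq_sym].
by rewrite sum_nat_const sum_V card_A mulnC eqxx => /esym/forall_inP/(_ j jV)/eqP.
Qed.

(* The square incidence matrix also has independent columns, whereas the
   alternating signs along an even cycle cancel on every edge. *)
Lemma incidence_free_cycle c : is_cycle e c -> odd (size c).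
Proof.
move=> cc; apply/negPn/negP => even_c; have /andP[sz_c /andP[cyc_c Uc]] := cc.
have sym_e : symmetric e by exact: pair_graph_sym.
pose g (v : 'I_n) : R := if v \in c then (-1) ^+ index v c else 0.
have g_next v : v \in c -> g v + g (next c v) = 0.
  move=> vc; rewrite /g mem_next vc -signr_odd -[X in _ + X]signr_odd.
  by rewrite odd_index_next //; case: odd; rewrite /= ?expr0 ?expr1 ?subrr ?addNr.
have g_edge v w : e v w -> g v + g w = 0.
  move=> evw; have := cycle_closed sym_e incidence_free_degree cc evw.
  have [vc|nvc] := boolP (v \in c) => wc; last by rewrite /g -wc (negPf nvc) addr0.
  case: (cycle_neighbour sym_e incidence_free_degree cc vc evw) => ->;
    last exact: g_next.
  by rewrite addrC -{2}(next_prev Uc v) g_next // mem_prev.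
pose y : 'cV[R]_#|V| := \col_j g (enum_val j).
have full_B : row_full B by rewrite /row_full (eqP row_free_B) card_A.
(* Each entry of [B *m y] is the sum of [g] over the two ends of a pair in [A], which [g_edge] makes
   0. *)
have y0 : y = 0.
  apply: (row_full_inj full_B); rewrite mulmx0; apply/colP => i; rewrite !mxE.
  have [v [w [_ Ep]]] := upairP (enum_val i).
  have evw : e v w.
    by apply/pair_graphP; exists (enum_val i) => //; exact: enum_valP.
  rewrite -[RHS](g_edge v w evw) -(sum_upair g Ep).
  under eq_bigr do rewrite !mxE.
  rewrite -(@big_enum_val _ _ _ _ [in V]
    (fun j => (j \in val (enum_val i))%:R * g j)).
  rewrite [LHS]big_mkcond [RHS]big_mkcond; apply: eq_bigr => j _ /=.
  case: (boolP (j \in sval (enum_val i))) => jp; last by rewrite mul0r if_same.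
  by rewrite mul1r (fintype.subsetP (sub_V (enum_valP i)) j jp).
have [v vc] : exists v, v \in c.
  case: c sz_c {cc even_c cyc_c Uc g g_next g_edge y y0} => // v c' _.
  by exists v; rewrite mem_head.
have vV : v \in V.
  by rewrite inE (degree2 incidence_free_degree (next_cycle cyc_c vc)).
move/colP/(_ (enum_rank_in vV v)): y0; rewrite !mxE enum_rankK_in // /g vc.
by move/eqP; rewrite signr_eq0.
Qed.

End Forward.

Definition nonint_pairs h : {set upair n} :=
  [set p | (h p : R) \isn't a Num.int]%SET.

Lemma nonintegral_graphE h : nonintegral_graph h = pair_graph (nonint_pairs h).
Proof.
apply/funext => i; apply/funext => j; rewrite /nonintegral_graph.
apply/andP/pair_graphP => [[nij]|[p + Ep]].
  rewrite /edge_label; case: insubP => [p _ Ep|]; last by rewrite rpred0.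
  by move=> h_p; exists p; rewrite // inE.
rewrite inE (edge_label_val h Ep) => h_p; split=> //.
by have := valP p; rewrite Ep cards2; case: (i != j).
Qed.

(** * Extreme points and the nonintegral coordinates of [h] *)

Section Vertex.
Variables (d : 'I_n -> nat) (h : {ffun upair n -> R^o}).
Hypothesis hP : realization_polytope d h.
Let A := nonint_pairs h.
Let e := pair_graph A.

Let h_sum j : \sum_(p : upair n | j \in val p) h p = (d j)%:R.
Proof. by have [hs _] := (realization_polytopeP d h).1 hP. Qed.

Let h01 p : 0 <= (h p : R) <= 1.
Proof. by have [_] := (realization_polytopeP d h).1 hP. Qed.

Let h_int p : p \notin A -> h p = 0 \/ h p = 1.
Proof.
rewrite inE negbK => /intrP[m Em]; have := h01 p.
rewrite Em ler0z lerz1 => m01.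
have [->|->] : m = 0 \/ m = 1 by lia.
  by left.
by right.
Qed.

Let h_nonint p : p \in A -> 0 < (h p : R) < 1.
Proof.
rewrite inE => h_p; have /andP[h0 h1] := h01 p.
rewrite !lt_neqAle h0 h1 !andbT; apply/andP; split.
  by apply: contraNneq h_p => <-; rewrite rpred0.
by apply: contraNneq h_p => ->; rewrite rpred1.
Qed.

(** A single nonintegral label at [j] would be the integer [d j] minus integers. *)
Lemma degree_nonint_neq1 j : degree e j != 1%N.
Proof.
rewrite degree_pair_graph; apply/negP => /cards1P[p Ap].
have /andP[pA jp] : (p \in A) && (j \in val p).
  by move/setP/(_ p): Ap; rewrite !inE eqxx.
move: (pA); rewrite inE => /negP; apply.
have := h_sum j; rewrite (bigD1 p) //= => /(canRL (addrK _)) ->.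
rewrite rpredB ?rpred_nat // rpred_sum // => q /andP[jq nqp].
apply: contraNT nqp => h_q; move/setP/(_ q): Ap.
by rewrite !inE h_q jq => /esym.
Qed.

Lemma incidence_free_extreme :
  incidence_free A -> extreme_point (realization_polytope d) h.
Proof.
move=> free_A; split=> // y z t yP zP /andP[t0 t1] Eh.
have [y_sum y01] := (realization_polytopeP d y).1 yP.
have [z_sum z01] := (realization_polytopeP d z).1 zP.
have Ehp p : (h p : R) = t * y p + (1 - t) * z p by rewrite Eh !ffunE.
have Ey : y = h.
  (* Off [A], [h p] is an endpoint of [0, 1], so a proper convex combination equal to it has both
     terms equal to it; the vertex sums of [y] and [h] agree. *)
  apply/eqP; rewrite -subr_eq0; apply/eqP/free_A => [p /h_int h_p|j].
    rewrite !ffunE; apply/eqP; rewrite subr_eq0; apply/eqP.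
    have := Ehp p; have := y01 p; have := z01 p.
    case: h_p => -> /andP[z0 z1] /andP[y0 y1] E; nra.
  under eq_bigr do rewrite !ffunE.
  by rewrite sumrB y_sum h_sum subrr.
split=> //; apply/ffunP => p; have := Ehp p; rewrite Ey => E.
have : (1 - t) * ((h p : R) - z p) = 0 by rewrite mulrBr mulrBl mul1r; lra.
by move/eqP; rewrite mulf_eq0 !subr_eq0 [1 == t]eq_sym lt_eqF // => /eqP.
Qed.

(** A relation [z] gives a segment from [h - s *: z] to [h + s *: z] inside the polytope with
    midpoint [h], so extremality forces [z = 0]. *)
Lemma extreme_incidence_free :
  extreme_point (realization_polytope d) h -> incidence_free A.
Proof.
case=> _ h_ext z zA z_sum.
(* The distance from [h p] to the nearer bound limits the step; adding 1 keeps the divisor positive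
   when [z p = 0]. In [s], the initial value 1 covers an empty [A]. *)
pose m p : R := Num.min (h p : R) (1 - (h p : R)) / (1 + `|z p : R|).
pose s : R := \big[Num.min/1]_(p in A) m p.
have z1 p : 0 < 1 + `|z p : R| by rewrite ltr_pwDl.
have s0 : 0 < s.
  apply: lt_bigmin => // p /h_nonint/andP[h0 h1].
  by rewrite divr_gt0 // lt_min h0 subr_gt0.
have s_small p : s * `|z p : R| <= h p /\ s * `|z p : R| <= 1 - (h p : R).
  have /andP[h0 h1] := h01 p; have [pA|/zA->] := boolP (p \in A); last first.
    by rewrite normr0 mulr0 subr_ge0.
  have : s * `|z p : R| <= Num.min (h p : R) (1 - (h p : R)).
    apply: (@le_trans _ _ (s * (1 + `|z p : R|))).
      by rewrite ler_pM2l // lerDr.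
    by rewrite -ler_pdivlMr //; exact: bigmin_le_cond.
  by rewrite le_min => /andP[].
have inP (r : R) : `|r| = s -> realization_polytope d (h + r *: z).
  move=> Er; apply/realization_polytopeP; split=> [j|p].
    under eq_bigr do rewrite !ffunE.
    rewrite big_split -scaler_sumr z_sum h_sum scaler0; exact: addr0.
  rewrite !ffunE /=; have [sh s1h] := s_small p.
  have : `|r * z p| <= s * `|z p : R| by rewrite normrM Er.
  rewrite ler_norml => /andP[? ?].
  by apply/andP; split; rewrite /GRing.scale /=; lra.
have half01 : 0 < (1 / 2 : R) < 1 by lra.
have [] := h_ext _ _ _ (inP s _) (inP (- s) _) half01.
- by rewrite gtr0_norm.
- by rewrite normrN gtr0_norm.
- by apply/ffunP => p; rewrite !ffunE /GRing.scale /=; lra.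
move=> + _ => /(canRL (addKr _)); rewrite addNr => /eqP.
by rewrite scaler_eq0 gt_eqF //= => /eqP.
Qed.

Lemma nonint_half : disjoint_odd_cycles e -> incidence_free A ->
  forall p, p \in A -> h p = 1 / 2 :> R.
Proof.
case=> deg_e _ free_A p pA.
pose z : {ffun upair n -> R^o} :=
  [ffun q => if q \in A then h q - (1 / 2 : R) else 0].
suff /ffunP/(_ p) : z = 0.
  by rewrite !ffunE pA => /eqP; rewrite subr_eq0 => /eqP.
apply: free_A => [q /negPf nqA|j]; first by rewrite ffunE nqA.
have -> : \sum_(q : upair n | j \in val q) z q =
    \sum_(q in [set q in A | j \in val q]%SET) (h q - (1 / 2 : R)).
  rewrite big_mkcond [RHS]big_mkcond; apply: eq_bigr => q _.
  by rewrite ffunE inE andbC; case: (j \in _); case: (q \in A).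
have := deg_e j; rewrite degree_pair_graph => -[/eqP|/eqP/cards2P[a [b [nab Ej]]]].
  by rewrite cards_eq0 => /eqP->; rewrite finset.big_set0.
rewrite Ej finset.big_setU1 ?inE //= finset.big_set1.
have [/andP[aA ja] /andP[bA jb]] :
    (a \in A) && (j \in val a) /\ (b \in A) && (j \in val b).
  by split; [move/setP/(_ a): Ej|move/setP/(_ b): Ej];
    rewrite !inE eqxx ?orbT.
(* All other labels at [j] are integral, so the two nonintegral ones have an integer sum strictly
   between 0 and 2, namely 1; hence the shifted labels cancel. *)
have : (h a : R) + h b \is a Num.int.
  have := h_sum j; rewrite (bigD1 a) //= (bigD1 b) /=; last by rewrite jb eq_sym.
  rewrite addrA => /(canRL (addrK _)) ->.
  rewrite rpredB ?rpred_nat // rpred_sum // => q /andP[/andP[jq nqa] nqb].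
  move/setP/(_ q): Ej; rewrite !inE jq andbT (negPf nqa) (negPf nqb) => /negbT.
  by rewrite negbK.
have := h_nonint aA; have := h_nonint bA.
move=> /andP[b0 b1] /andP[a0 a1] /intrP[m Em].
have m0 : 0 < m by rewrite -(ltr0z R) -Em; lra.
have m2 : m < 2 by rewrite -(ltr_int R) -Em; lra.
have m1 : m = 1 by lia.
by rewrite m1 in Em; lra.
Qed.

Lemma even_nonint : graphic d -> (forall p, p \in A -> h p = 1 / 2 :> R) ->
  ~~ odd #|A|.
Proof.
case=> f [sym_f irr_f] deg_f half.
have even_d : ~~ odd (\sum_j d j)%N.
  by under eq_bigr do rewrite -deg_f; exact: odd_sum_degree.
(* Each pair contributes to the vertex sums of its two ends. *)
have Eh : (\sum_p (h p : R)) *+ 2 = (\sum_j d j)%:R.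
  rewrite natr_sum; under [RHS]eq_bigr do rewrite -h_sum.
  rewrite (exchange_big_dep predT) //= -sumrMnl; apply: eq_bigr => p _.
  by rewrite sumr_const (eqP (valP p)).
have Eh' : (\sum_p (h p : R)) = #|A|%:R / 2 + (\sum_(p | p \notin A) (h p : R)).
  rewrite (bigID [in A]) /=; congr (_ + _).
  rewrite (eq_bigr (fun=> 1 / 2 : R)); last by move=> p; exact: half.
  by rewrite sumr_const div1r mulr_natl.
have /intrP[k Ek] : \sum_(p | p \notin A) (h p : R) \is a Num.int.
  by rewrite rpred_sum // => p; rewrite inE negbK.
have Ed : (\sum_j d j = ((\sum_j d j)./2).*2)%N.
  by rewrite -[LHS]odd_double_half (negPf even_d).
move: Eh; rewrite Eh' Ek Ed -muln2 natrM => E.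
(* The total of [h] is [#|A| / 2 + k] and also half the degree sum; clearing the denominator moves
   the equation to the integers, where parity is visible. *)
have : (#|A|%:Z = ((\sum_j d j)./2%:Z - k) * 2)%R.
  apply: (@intr_inj R); rewrite rmorphM rmorphB /= -!pmulrn.
  by move: E; lra.
by lia.
Qed.

End Vertex.
End PairSets.

Theorem theorem1 (R : realType) (n : nat) (d : 'I_n -> nat)
    (h : {ffun upair n -> R^o}) :
  graphic d ->
  realization_polytope d h ->
  (extreme_point (realization_polytope d) h <->
     disjoint_odd_cycles (nonintegral_graph h)) /\
  (extreme_point (realization_polytope d) h ->
     ~~ odd #|cycles (nonintegral_graph h)| /\
     forall p : upair n, (h p : R) \isn't a Num.int -> h p = 1 / 2 :> R).
Proof.
move=> d_graphic hP; rewrite nonintegral_graphE.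
set e := pair_graph _.
have vertex_cycles :
    extreme_point (realization_polytope d) h -> disjoint_odd_cycles e.
  move/(extreme_incidence_free hP) => free_h; have deg1 := degree_nonint_neq1 hP.
  by split; [exact: (incidence_free_degree free_h deg1)
    | exact: (incidence_free_cycle free_h deg1)].
split.
  split=> // -[deg_e odd_e]; apply: incidence_free_extreme => //.
  exact: incidence_free_odd.
move=> ext; have cyc := vertex_cycles ext; have [deg_e odd_e] := cyc.
have half := nonint_half hP cyc (extreme_incidence_free hP ext).
split; last by move=> p h_p; apply: half; rewrite inE.
rewrite odd_card_cycles //; [|exact: pair_graph_sym|exact: pair_graph_irr].
rewrite graph_edges_pair_graph card_imset; last exact: val_inj.
exact: even_nonint hP d_graphic half.
Qed.
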